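(* The $\mathbb{Z}$-linear span of left increasing trees is a Hopf subalgebra of the cocommutative Hopf algebra $(\mathcal{T}_\bullet,\overline{\ast},\hat{\delta})$ of increasing trees; via $\mathsf{Inc}$ this makes the linear span of (planar rooted) trees a graded connected cocommutative Hopf algebra (an enveloping algebra). It is free as an associative algebra, and (after extending scalars to $\mathbb{Q}$) it is the universal enveloping algebra of a free Lie algebra.
   Context: Trees: finite planar rooted trees in which each vertex has one outgoing edge and at least two ordered incoming edges; $\varepsilon$ the trivial tree; $\bigvee(T_0,\ldots,T_m)$ joins roots of $T_0,\ldots,T_m$ to a new vertex with new root. A vertex with $j+1$ incoming edges carries $j$ branchings (pairs of consecutive incoming edges). Branchings are ordered left to right recursively ($b_i\prec b\prec b_{i+1}$ for $b$ in $T_i$, $b_1,\ldots,b_m$ the root branchings of $\bigvee(T_0,\ldots,T_m)$), giving the natural labelling by $[n]=\{1,\ldots,n\}$. A level function is a surjection from vertices onto $[k]$ strictly increasing along leaf-to-root paths; an increasing tree is $(T,\lambda)$. $\sigma(T,\lambda)=(P_1,\ldots,P_k)$, $P_i$ the natural labels of branchings at level $i$, is a bijection onto set compositions of $[n]$ (tuples of pairwise disjoint non-empty sets with union $[n]$); $\mathcal{T}_\bullet$ is the free $\mathbb{Z}$-module on increasing trees, identified with set compositions via $\sigma$. For $P=(P_1,\ldots,P_k)$ a set composition of $[p]$ and $Q=(Q_1,\ldots,Q_l)$ of $[q]$: $P\,\overline{\ast}\,Q=(P_1,\ldots,P_k,p+Q_1,\ldots,p+Q_l)$ ($p+X=\{p+x\}$);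 for $A\subseteq[n]$, $P|_A$ is $(P_1\cap A,\ldots)$ with empty entries deleted and $A$ relabelled to $[|A|]$ order-preservingly; $\hat{\delta}(P)=\sum_{A\sqcup B=[n]}P|_A\otimes P|_B$. $\mathsf{Inc}$: $\mathsf{Inc}(\varepsilon)=\varepsilon$; if $T=\bigvee(T_0,\ldots,T_m)$ and $\mathsf{Inc}(T_i)=(T_i,\lambda_i)$ with $k_i$ levels, $\mathsf{Inc}(T)=(T,\lambda)$ with $\lambda(v)=k_0+\cdots+k_{i-1}+\lambda_i(v)$ for $v$ in $T_i$ and root vertex level $k_0+\cdots+k_m+1$. Left increasing trees are those in the image of $\mathsf{Inc}$. *)

(* Defs.v *)
From mathcomp Require Import all_boot all_order all_algebra.
Set Implicit Arguments. Unset Strict Implicit. Unset Printing Implicit Defensive.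
Import GRing.Theory.
Local Open Scope ring_scope.

Inductive tree : Type := Leaf | Node of seq tree.

Fixpoint wf_tree (t : tree) : bool :=
  match t with
  | Leaf => true
  | Node cs => (1 < size cs)%N && all wf_tree cs
  end.

Inductive ltree : Type := LLeaf | LNode of nat & seq ltree.

Fixpoint lshift (d : nat) (t : ltree) : ltree :=
  match t with
  | LLeaf => LLeaf
  | LNode l cs => LNode (l + d)%N (map (lshift d) cs)
  end.

Fixpoint shift_children (off : nat) (rs : seq (ltree * nat)) : seq ltree * nat :=
  match rs with
  | [::] => ([::], off)
  | r :: rs' => let: (l, o) := shift_children (off + r.2)%N rs' in
                (lshift off r.1 :: l, o)
  end.

(* Inc : tree -> increasing tree, returned with its number of levels k *)
Fixpoint Inc (t : tree) : ltree * nat :=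
  match t with
  | Leaf => (LLeaf, 0%N)
  | Node cs => let: (cs', k) := shift_children 0 (map Inc cs) in
               (LNode k.+1 cs', k.+1)
  end.

(* levels of the branchings, listed in the natural (left-to-right) order:
   branchings of T0, b1, branchings of T1, b2, ..., bm, branchings of Tm;
   the root branchings b1..bm sit at the level of the root vertex. *)
Fixpoint blevels (t : ltree) : seq nat :=
  match t with
  | LLeaf => [::]
  | LNode l cs =>
      match cs with
      | [::] => [::]
      | c0 :: cs' => blevels c0 ++ flatten (map (fun c => l :: blevels c) cs')
      end
  end.

(* A set composition (P_1,...,P_k) of [n] is a list of blocks, each block
   being the increasing list of its elements. *)
Definition setcomp := seq (seq nat).

Definition sigma (t : ltree) (k : nat) : setcomp :=
  let L := blevels t in
  [seq [seq i <- iota 1 (size L) | nth 0%N L i.-1 == j] | j <- iota 1 k].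

(* left increasing trees, read as set compositions *)
Definition is_LIT (P : setcomp) : Prop :=
  exists t, wf_tree t /\ sigma (Inc t).1 (Inc t).2 = P.

Definition sc_size (P : setcomp) : nat := sumn (map size P).

Definition sc_mul (P Q : setcomp) : setcomp :=
  P ++ map (map (addn (sc_size P))) Q.

Fixpoint subseqs (s : seq nat) : seq (seq nat) :=
  match s with
  | [::] => [:: [::]]
  | x :: s' => let r := subseqs s' in map (cons x) r ++ r
  end.

Definition restr (P : setcomp) (A : seq nat) : setcomp :=
  filter (fun b => b != [::])
    [seq [seq (index x A).+1 | x <- b & x \in A] | b <- P].

Definition sc_delta (P : setcomp) : seq (setcomp * setcomp) :=
  let N := iota 1 (sc_size P) in
  [seq (restr P A, restr P [seq x <- N | x \notin A]) | A <- subseqs N].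

Section LinComb.
Variable R : comNzRingType.

Definition lc := seq (R * setcomp).
Definition lc2 := seq (R * (setcomp * setcomp)).

Definition coef (x : lc) (P : setcomp) : R := \sum_(p <- x | p.2 == P) p.1.
Definition coef2 (x : lc2) (PQ : setcomp * setcomp) : R :=
  \sum_(p <- x | p.2 == PQ) p.1.

Definition lc_eq (x y : lc) : Prop := forall P, coef x P = coef y P.
Definition lc2_eq (x y : lc2) : Prop := forall PQ, coef2 x PQ = coef2 y PQ.

Definition lc_one : lc := [:: (1, [::])].
Definition lc_scale (a : R) (x : lc) : lc := [seq (a * p.1, p.2) | p <- x].
Definition lc_mul (x y : lc) : lc :=
  [seq (p.1 * q.1, sc_mul p.2 q.2) | p <- x, q <- y].
Definition lc_delta (x : lc) : lc2 :=
  [seq (p.1, d) | p <- x, d <- sc_delta p.2].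

(* antipode, determined recursively by  m (S (x) id) hat_delta = unit . counit:
   S(P) = - sum_{A |_| B = [n], B nonempty} S(P|_A) * P|_B   for P nonempty *)
Fixpoint antip (f : nat) (P : setcomp) : lc :=
  if P == [::] then lc_one else
  match f with
  | 0%N => [::]
  | f'.+1 => lc_scale (-1)
      (flatten [seq lc_mul (antip f' d.1) [:: (1, d.2)]
               | d <- sc_delta P & d.2 != [::]])
  end.
Definition lc_antipode (x : lc) : lc :=
  flatten [seq lc_scale p.1 (antip (sc_size p.2) p.2) | p <- x].

Definition in_LIT (x : lc) : Prop :=
  exists y : lc, (forall p, p \in y -> is_LIT p.2) /\ lc_eq x y.
Definition in_LIT2 (z : lc2) : Prop :=
  exists y : lc2, (forall p, p \in y -> is_LIT p.2.1 /\ is_LIT p.2.2) /\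
                  lc2_eq z y.

Definition primitive (x : lc) : Prop :=
  lc2_eq (lc_delta x)
    ([seq (p.1, (p.2, [::])) | p <- x] ++ [seq (p.1, ([::], p.2)) | p <- x]).

Definition word_prod (I : Type) (g : I -> lc) (w : seq I) : lc :=
  foldr (fun i acc => lc_mul (g i) acc) lc_one w.
Definition lc_comb (I : Type) (g : I -> lc) (c : seq (R * seq I)) : lc :=
  flatten [seq lc_scale p.1 (word_prod g p.2) | p <- c].

Definition freely_generates (I : eqType) (g : I -> lc) : Prop :=
  [/\ forall i, in_LIT (g i),
      forall x, in_LIT x -> exists c : seq (R * seq I), lc_eq x (lc_comb g c)
    & forall c : seq (R * seq I), uniq (map snd c) ->
        lc_eq (lc_comb g c) [::] -> forall p, p \in c -> p.1 = 0].
End LinComb.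

(* Main.v *)
Require Import Defs.
From mathcomp Require Import all_boot all_order all_algebra.
From mathcomp Require Import boolp zify ring.

(** A set composition of [n] is recorded by a word of length n, the level of
    each branching, up to order isomorphism. The words of left increasing trees
    are those with no subword abc such that c <= a < b: cutting a word at its
    largest letter m, this condition says that the pieces are again such words
    and that their letters increase from each piece to the next, which is the
    recursion defining [Inc]. The condition passes to subwords, whence stability
    under the coproduct, and to shifted concatenations, whence stability under
    the product; the antipode follows from its recursion.

    Cutting a word just before its first maximal letter factors a left
    increasing tree as a product; the right factor starts with its largest
    letter, and such trees freely generate the monoid of left increasing trees.
    Over the rationals each generator P is replaced by D(P)/n, with D = S * Y
    the Dynkin operator (S the antipode, Y the degree, * the convolution): by
    cocommutativity it is primitive, and it equals P plus products of at least
    two generators, so a triangularity argument on the number of factors gives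
    free generation. *)

Set Implicit Arguments. Unset Strict Implicit. Unset Printing Implicit Defensive.

(** * Words and set compositions *)

Definition positions (w : seq nat) (j : nat) : seq nat :=
  [seq i <- iota 1 (size w) | nth 0 w i.-1 == j].

Definition letters (w : seq nat) : seq nat := sort leq (undup w).

(* The set composition of a word of levels; the levels need not be consecutive. *)
Definition SC (w : seq nat) : setcomp := [seq positions w j | j <- letters w].

Lemma mem_letters w : letters w =i w.
Proof. by move=> x; rewrite mem_sort mem_undup. Qed.

Lemma letters_sorted w : sorted ltn (letters w).
Proof.
rewrite ltn_sorted_uniq_leq sort_uniq undup_uniq.
exact: (sort_sorted leq_total).
Qed.

Lemma lettersE w s : sorted ltn s -> s =i w -> letters w = s.
Proof.
move=> ss sw; apply: (irr_sorted_eq ltn_trans ltnn) => //.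
  exact: letters_sorted.
by move=> x; rewrite mem_letters sw.
Qed.

Lemma positions_cat u v j :
  positions (u ++ v) j =
  positions u j ++ [seq size u + i | i <- positions v j].
Proof.
rewrite /positions size_cat iotaD filter_cat; congr (_ ++ _).
  apply: eq_in_filter => i; rewrite mem_iota nth_cat => hi.
  by have -> : i.-1 < size u by lia.
rewrite addnC iotaDl filter_map; congr map; apply: eq_in_filter => i /=.
rewrite mem_iota nth_cat => hi.
have -> : (size u + i).-1 < size u = false by lia.
by congr (nth _ _ _ == _); lia.
Qed.

Lemma positions1 x j : positions [:: x] j = if x == j then [:: 1] else [::].
Proof. by []. Qed.

Lemma positions_cons x w j :
  positions (x :: w) j =
  (if x == j then [:: 1] else [::]) ++ map succn (positions w j).
Proof. by rewrite -cat1s positions_cat positions1. Qed.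

Lemma mem_positions w j i :
  (i \in positions w j) = [&& 0 < i, i <= size w & nth 0 w i.-1 == j].
Proof. by rewrite mem_filter mem_iota andbC; lia. Qed.

Lemma size_positions w j : size (positions w j) = count_mem j w.
Proof.
elim: w => //= x w IH; rewrite positions_cons size_cat size_map IH.
by case: eqP.
Qed.

Lemma positions_nil w j : (positions w j == [::]) = (j \notin w).
Proof. by rewrite -size_eq0 size_positions -has_pred1 has_count -eqn0Ngt. Qed.

Lemma sumn_count (s w : seq nat) : uniq s -> {subset w <= s} ->
  sumn [seq count_mem j w | j <- s] = size w.
Proof.
move=> us; elim: w => [|x w IH] ws.
  by rewrite sumnE big_map big1.
rewrite /= -IH; last by move=> y yw; apply: ws; rewrite inE yw orbT.
have xs : x \in s by apply: ws; rewrite inE eqxx.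
rewrite !sumnE !big_map big_split /= -[RHS]add1n; congr (_ + _).
under eq_bigr => j _ do rewrite eq_sym.
elim: s us xs {IH ws} => //= y s IH /andP[ys us].
rewrite inE big_cons => /orP[/eqP e0|xs]; first subst x.
  rewrite eqxx big1_seq // => i /= iS; case: eqP => // e.
  by case/negP: ys; subst.
rewrite IH //; case: eqP => // e; by case/negP: ys; subst.
Qed.

Lemma size_SC w : sc_size (SC w) = size w.
Proof.
rewrite /sc_size -map_comp (@eq_map _ _ _ (fun j => count_mem j w)); last first.
  by move=> j; rewrite /= size_positions.
apply: sumn_count; first by rewrite sort_uniq undup_uniq.
by move=> x; rewrite mem_letters.
Qed.

Lemma SC_nil : SC [::] = [::]. Proof. by []. Qed.

Lemma SC_eq0 w : (SC w == [::]) = (w == [::]).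
Proof.
apply/eqP/eqP => [e|->//].
by apply/nilP; rewrite /nilp -size_SC e.
Qed.

Lemma SC_block w b : b \in SC w -> b != [::].
Proof. by case/mapP => j jw ->; rewrite positions_nil negbK -mem_letters. Qed.

(** Only the relative order of letters matters: [f] is injective on [w] and preserves the sorting of
    its letters, so no list of positions changes. *)
Lemma SC_map (f : nat -> nat) (w : seq nat) :
  {in w &, forall x y, (f x < f y) = (x < y)} -> SC (map f w) = SC w.
Proof.
move=> hf.
have le : letters (map f w) = map f (letters w).
  apply: lettersE; last first.
    move=> x; apply/mapP/mapP => -[y yw ->]; exists y => //.
      by rewrite -mem_letters.
    by rewrite mem_letters.
  apply: (homo_sorted_in (P := mem w)) (letters_sorted w).
    by move=> x y xw yw xy; change (f x < f y); rewrite hf.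
  by apply/allP => x; rewrite mem_letters.
rewrite /SC le -map_comp; apply/eq_in_map => j; rewrite mem_letters => jw /=.
rewrite /positions size_map; apply: eq_in_filter => i; rewrite mem_iota => hi.
have iw : i.-1 < size w by lia.
rewrite (nth_map 0) //.
have := hf _ _ (mem_nth 0 iw) jw; have := hf _ _ jw (mem_nth 0 iw).
by move=> h1 h2; apply/eqP/eqP => [e|-> //]; move: h1 h2; rewrite e ltnn; case: ltngtP.
Qed.

(** Sorting puts the letters of [u] first, and positions in [v] move by the length of [u], which is
    the shift in [sc_mul]. *)
Lemma SC_cat u v : allrel ltn u v -> SC (u ++ v) = sc_mul (SC u) (SC v).
Proof.
move=> /allrelP uv.
have -> : SC (u ++ v) = [seq positions (u ++ v) j | j <- letters u ++ letters v].
  congr map; apply: lettersE.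
    rewrite (sorted_pairwise ltn_trans) pairwise_cat.
    rewrite -!(sorted_pairwise ltn_trans) !letters_sorted !andbT.
    by apply/allrelP => x y; rewrite !mem_letters; apply: uv.
  by move=> x; rewrite !mem_cat !mem_letters.
rewrite map_cat /sc_mul size_SC; congr (_ ++ _).
  apply/eq_in_map => j; rewrite mem_letters => ju.
  rewrite positions_cat (_ : positions v j = [::]) ?cats0 //.
  apply/eqP; rewrite positions_nil; apply/negP => jv.
  by have := uv _ _ ju jv; rewrite /= ltnn.
rewrite -map_comp; apply/eq_in_map => j; rewrite mem_letters => jv /=.
rewrite positions_cat (_ : positions u j = [::]) //.
apply/eqP; rewrite positions_nil; apply/negP => ju.
by have := uv _ _ ju jv; rewrite /= ltnn.
Qed.

Lemma sc_mul_SC u v :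
  (* The successor lifts even a letter 0 of [v] above every letter of [u]. *)
  let c := (\max_(x <- u) x).+1 in
  sc_mul (SC u) (SC v) = SC (u ++ map (addn c) v) /\
  allrel ltn u (map (addn c) v).
Proof.
move=> c.
have h : allrel ltn u (map (addn c) v).
  apply/allrelP => x _ xu /mapP[y _ ->].
  by have : x <= \max_(x <- u) x by [apply: leq_bigmax_seq]; rewrite /c; lia.
split=> //; rewrite SC_cat // (@SC_map (addn c)) // => x y _ _; lia.
Qed.

Lemma filter_index (A : seq nat) (q : pred nat) : uniq A ->
  [seq (index x A).+1 | x <- A & q x] =
  [seq i <- iota 1 (size A) | q (nth 0 A i.-1)].
Proof.
move=> uA; have {2}-> : A = [seq nth 0 A i.-1 | i <- iota 1 (size A)].
  rewrite (iotaDl 1 0) -map_comp -[LHS](mkseq_nth 0) /mkseq.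
  by apply: eq_map => i.
rewrite filter_map -map_comp -[RHS]map_id.
rewrite -(eq_filter (a1 := preim (fun i => nth 0 A i.-1) q)) //.
apply/eq_in_map => i; rewrite mem_filter mem_iota => /andP[_ hi] /=.
by case: i hi => [|i] hi //; rewrite index_uniq //=; lia.
Qed.

(** Restriction to a set of positions is passage to a subword. Levels absent from the subword give
    the empty blocks that [restr] deletes, which is why [SC] tolerates gaps between levels. *)
Lemma restr_SC w m : size m = size w ->
  restr (SC w) (mask m (iota 1 (size w))) = SC (mask m w).
Proof.
move=> sm; set N := iota 1 _; set A := mask m N.
have uA : uniq A by rewrite mask_uniq // iota_uniq.
have wE : w = [seq nth 0 w x.-1 | x <- N].
  rewrite /N (iotaDl 1 0) -map_comp -[LHS](mkseq_nth 0) /mkseq.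
  by apply: eq_map => i.
have blk j : [seq (index x A).+1 | x <- positions w j & x \in A] =
    positions (mask m w) j.
  have -> : [seq x <- positions w j | x \in A] = [seq x <- A | nth 0 w x.-1 == j].
    rewrite /positions -/N [in RHS]/A (mask_filter m (iota_uniq _ _)) -/A.
    by rewrite -!filter_predI; apply: eq_filter => x /=; rewrite andbC.
  rewrite filter_index // /positions {2 3}wE -map_mask -/A size_map.
  apply: eq_in_filter => i; rewrite mem_iota => hi.
  rewrite (nth_map 0) //; lia.
rewrite /restr /SC -map_comp (eq_map (g := positions (mask m w))) //.
rewrite filter_map; congr map.
apply/esym/lettersE; first by rewrite sorted_filter ?letters_sorted //; apply: ltn_trans.
move=> j; rewrite mem_filter /= positions_nil negbK mem_letters.
by case jw : (j \in mask m w) => //=; rewrite (mem_mask jw).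
Qed.

(** * Unshuffles of words *)

Fixpoint masks n : seq bitseq :=
  if n is n'.+1 then map (cons true) (masks n') ++ map (cons false) (masks n')
  else [:: [::]].

Lemma size_masks n m : m \in masks n -> size m = n.
Proof.
elim: n m => [|n IH] m /=; first by rewrite inE => /eqP->.
by rewrite mem_cat => /orP[] /mapP[m' /IH<- ->].
Qed.

Lemma subseqsE s : subseqs s = [seq mask m s | m <- masks (size s)].
Proof. by elim: s => //= x s ->; rewrite map_cat -!map_comp. Qed.

(** All splittings into complementary subwords, listed in the order of [subseqs], so that
    [sc_delta_SC] is an equality of lists. *)
Definition unsh (w : seq nat) : seq (seq nat * seq nat) :=
  [seq (mask m w, mask (map negb m) w) | m <- masks (size w)].

Lemma unsh_cons x w : unsh (x :: w) =
  [seq (x :: d.1, d.2) | d <- unsh w] ++ [seq (d.1, x :: d.2) | d <- unsh w].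
Proof. by rewrite /unsh /= map_cat -!map_comp. Qed.

Lemma mask_negb (T : eqType) m (s : seq T) : uniq s -> size m = size s ->
  [seq x <- s | x \notin mask m s] = mask (map negb m) s.
Proof.
elim: s m => [|x s IH] [|b m] //= /andP[xs us] [sm].
have xm : x \notin mask m s by apply: contra xs; apply: mem_mask.
have e : [seq y <- s | y \notin x :: mask m s] = [seq y <- s | y \notin mask m s].
  apply: eq_in_filter => y ys; rewrite inE; case: eqP => // e.
  by rewrite -e ys in xs.
case: b => /=; first by rewrite inE eqxx /= e IH.
by rewrite xm IH.
Qed.

Lemma sc_delta_SC w : sc_delta (SC w) = [seq (SC d.1, SC d.2) | d <- unsh w].
Proof.
rewrite /sc_delta size_SC subseqsE size_iota -!map_comp.
apply/eq_in_map => m /size_masks sm /=.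
rewrite mask_negb ?iota_uniq ?size_iota // !restr_SC ?size_map //.
Qed.

(** * Words of left increasing trees *)

Definition avoid (w : seq nat) : Prop :=
  forall a b c, subseq [:: a; b; c] w -> c <= a -> b <= a.

Lemma avoid_subseq u w : subseq u w -> avoid w -> avoid u.
Proof. by move=> uw aw a b c s; apply: aw; apply: subseq_trans uw. Qed.

Lemma avoid_map (f : nat -> nat) (w : seq nat) :
  {mono f : x y / x <= y} -> avoid w -> avoid (map f w).
Proof.
move=> hf aw a b c /subseqP[m _].
rewrite -map_mask => e ca.
have s : subseq (mask m w) w by exact: mask_subseq.
case: (mask m w) s e => [|a' [|b' [|c' []]]] //= s [ea eb ec].
by move: ca; rewrite ea eb ec !hf; apply: aw.
Qed.

Lemma subseq_catl (s u v : seq nat) : subseq s (u ++ v) ->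
  exists s1 s2, [/\ s = s1 ++ s2, subseq s1 u & subseq s2 v].
Proof.
case/subseqP => m; rewrite size_cat => sm ->.
exists (mask (take (size u) m) u), (mask (drop (size u) m) v).
rewrite !mask_subseq -{1}[m](cat_take_drop (size u)) mask_cat //.
by rewrite size_takel // sm leq_addr.
Qed.

(** A subword [abc] that meets both parts has [a] in [u] and [c] in [v], so [a < c] and nothing is
    required of it. *)
Lemma avoid_cat (u v : seq nat) :
  allrel ltn u v -> avoid u -> avoid v -> avoid (u ++ v).
Proof.
move=> /allrelP uv au av a b c /subseq_catl[s1 [s2 [e s1u s2v]]] ca.
case: s1 e s1u => [|x s1] e s1u.
  by apply: av ca; rewrite e.
case: e => ? e; subst x; have xu : a \in u by apply: (mem_subseq s1u); rewrite inE eqxx.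
case: (eqVneq s2 [::]) => [e2|s20].
  by move: e; rewrite e2 cats0 => e; apply: au ca; rewrite e.
have cs : c \in s2.
  have := congr1 (last 0) e; rewrite last_cat /= => ->.
  by case: (s2) s20 => //= y s _; rewrite mem_last.
by have /= := uv _ _ xu (mem_subseq s2v cs); rewrite ltnNge ca.
Qed.

Lemma avoid_cons (m : nat) (v : seq nat) : all (geq m) v -> avoid v -> avoid (m :: v).
Proof.
move=> vm av a b c; rewrite /= ; case: eqP => [-> s _|_ s]; last exact: av.
have : b \in v by apply: (mem_subseq s); rewrite inE eqxx.
by move/(allP vm).
Qed.

(** * Joining words by a separator *)

Fixpoint join (m : nat) (ws : seq (seq nat)) : seq nat :=
  match ws with
  | [::] => [::]
  | w :: ws' => if nilp ws' then w else w ++ m :: join m ws'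
  end.

Lemma joinE m w ws :
  join m (w :: ws) = w ++ flatten [seq m :: v | v <- ws].
Proof.
elim: ws w => [|v ws IH] w; first by rewrite cats0.
by rewrite -[join _ _]/(w ++ m :: join m (v :: ws)) IH.
Qed.

Lemma mem_join m ws x :
  (x \in join m ws) = (1 < size ws) && (x == m) || has (mem^~ x) ws.
Proof.
case: ws => [|w ws] //; elim: ws w => [|v ws IH] w; first by rewrite /= orbF.
rewrite -[join _ _]/(w ++ m :: join m (v :: ws)) mem_cat inE IH /=.
by case: (x \in w); case: (x == m); rewrite /= ?orbT ?andbF ?andbT.
Qed.

Definition bounded m (ws : seq (seq nat)) := all (all (gtn m)) ws.
Definition increasing (ws : seq (seq nat)) := pairwise (allrel ltn) ws.

Lemma join_le m ws : bounded m ws -> all (geq m) (join m ws).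
Proof.
move=> /allP bw; apply/allP => x; rewrite mem_join /= => /orP[/andP[_ /eqP->//]|].
by case/hasP => w /bw /allP h /h /ltnW.
Qed.

Lemma allrel_join m w ws : all (gtn m) w -> all (allrel ltn w) ws ->
  allrel ltn w (m :: join m ws).
Proof.
move=> /allP wm /allP ww; apply/allrelP => x y xw.
rewrite inE mem_join => /orP[/eqP->|/orP[/andP[_ /eqP->]|]]; try exact: wm.
by case/hasP => v /ww /allrelP h; apply: h.
Qed.

Lemma avoid_join m ws : bounded m ws -> increasing ws ->
  (forall w, w \in ws -> avoid w) -> avoid (join m ws).
Proof.
elim: ws => [|w ws IH] //.
rewrite /bounded /increasing /= => /andP[wm bw] /andP[ww iw] aw.
have a0 : avoid w by apply: aw; rewrite inE eqxx.
case: nilP => // _; apply: avoid_cat => //; first exact: allrel_join.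
apply: avoid_cons; first exact: join_le.
by apply: IH => // v vw; apply: aw; rewrite inE vw orbT.
Qed.

Lemma avoid_join_inv m ws : bounded m ws -> avoid (join m ws) ->
  increasing ws /\ forall w, w \in ws -> avoid w.
Proof.
elim: ws => [|w ws IH] //.
rewrite /bounded /increasing [join _ _]/= [all _ _]/= => /andP[wm bw].
case: nilP => [-> aw|_ aw]; first by split=> // v; rewrite inE => /eqP->.
have [iw aws] : increasing ws /\ (forall w, w \in ws -> avoid w).
  by apply: IH => //; apply: avoid_subseq aw; rewrite -cat_rcons suffix_subseq.
split; last first.
  move=> v; rewrite inE => /orP[/eqP->|]; last exact: aws.
  by apply: avoid_subseq aw; apply: prefix_subseq.
rewrite /= -/(increasing _) iw andbT; apply/allP => v vw; apply/allrelP => x y xw yv /=.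
rewrite ltnNge; apply/negP => yx.
(* The separator stands between [x] and [y], so [x], [m], [y] would be a forbidden subword. *)
have /(_ yx) : y <= x -> m <= x.
  apply: aw; rewrite -[_ :: _]/([:: x] ++ [:: m; y]).
  apply: cat_subseq; rewrite ?sub1seq //= eqxx sub1seq mem_join.
  by apply/orP; right; apply/hasP; exists v.
by have /= := allP wm x xw; lia.
Qed.

(** No piece contains [m], so the occurrences of [m] are exactly the cuts. Non-emptiness separates
    [[::]] from [[:: [::]]], which join to the same word. *)
Lemma join_inj m ws ws' : bounded m ws -> bounded m ws' ->
  0 < size ws -> 0 < size ws' -> join m ws = join m ws' -> ws = ws'.
Proof.
have nm w : all (gtn m) w -> m \notin w.
  by move=> h; apply/negP => /(allP h) /=; rewrite ltnn.
have cut w w' J J' : all (gtn m) w -> all (gtn m) w' ->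
    w ++ m :: J = w' ++ m :: J' -> w = w' /\ J = J'.
  move=> /nm mw /nm mw' e.
  have i (x y : seq nat) : m \notin x -> index m (x ++ m :: y) = size x.
    by move=> mx; rewrite index_cat (negPf mx) /= eqxx addn0.
  have s : size w = size w' by rewrite -(i w J) // e i.
  move/eqP: e; rewrite eqseq_cat // => /andP[/eqP-> /eqP[->]] //.
elim: ws ws' => [|w ws IH] [|w' ws'] //.
rewrite /bounded /= => /andP[wm bw] /andP[wm' bw'] _ _.
case: ws IH bw => [|v ws] IH bw; case: ws' bw' => [|v' ws'] bw'.
- by move=> /= ->.
- rewrite -[nilp [::]]/true -[nilp (_ :: _)]/false => e; case/negP: (nm _ wm).
  by rewrite e mem_cat inE eqxx orbT.
- rewrite -[nilp [::]]/true -[nilp (_ :: _)]/false => e; case/negP: (nm _ wm').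
  by rewrite -e mem_cat inE eqxx orbT.
rewrite -[nilp (v :: _)]/false -[nilp (_ :: _)]/false => /cut[] // -> e.
by rewrite (IH (v' :: ws')).
Qed.

Lemma join_split m (w : seq nat) : all (geq m) w ->
  exists ws, [/\ join m ws = w, bounded m ws, 0 < size ws &
              m \in w -> 1 < size ws].
Proof.
elim: w => [|x w IH] /=; first by exists [:: [::]].
case/andP => xm /IH[[|v ws] [e b s1 s2]] //.
move: xm; rewrite leq_eqVlt => /orP[/eqP->|xm].
  exists ([::] :: v :: ws); split=> //.
  by rewrite -e.
exists ((x :: v) :: ws); split=> //.
- by rewrite -e; case: (ws).
- by move: b; rewrite /bounded /= xm.
- by rewrite inE; case: eqP xm => [->|_ _ /s2]; rewrite ?ltnn.
Qed.

(** * Order isomorphism of words *)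

Definition oiso (u v : seq nat) : Prop :=
  size u = size v /\
  {in zip u v &, forall p q : nat * nat, (p.1 <= q.1) = (p.2 <= q.2)}.

Lemma zip_letters (u v : seq nat) p : p \in zip u v -> p.1 \in u /\ p.2 \in v.
Proof.
elim: u v => [|x u IH] [|y v] //=; rewrite !inE => /orP[/eqP->|/IH[-> ->]].
  by rewrite !eqxx.
by rewrite !orbT.
Qed.

Lemma oiso_cat u u' v v' : oiso u u' -> oiso v v' ->
  allrel ltn u v -> allrel ltn u' v' -> oiso (u ++ v) (u' ++ v').
Proof.
move=> [su hu] [sv hv] /allrelP uv /allrelP uv'.
split=> [|p q]; first by rewrite !size_cat su sv.
rewrite zip_cat // !mem_cat => /orP[pu|pv] /orP[qu|qv].
- exact: hu.
- have [a b] := zip_letters pu; have [c d] := zip_letters qv.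
  by rewrite (ltnW (uv _ _ a c)) (ltnW (uv' _ _ b d)).
- have [a b] := zip_letters qu; have [c d] := zip_letters pv.
  by have /= := uv _ _ a c; have /= := uv' _ _ b d; rewrite !ltnNge => /negPf-> /negPf->.
- exact: hv.
Qed.

Lemma oiso_max m m' u u' : oiso u u' -> all (gtn m) u -> all (gtn m') u' ->
  oiso (m :: u) (m' :: u').
Proof.
move=> [su hu] /allP um /allP um'; split=> [|p q] /=; first by rewrite su.
rewrite !inE => /orP[/eqP->|pu] /orP[/eqP->|qu] /=.
- by rewrite !leqnn.
- have [a b] := zip_letters qu; have /= := um _ a; have /= := um' _ b.
  by rewrite !ltnNge => /negPf-> /negPf->.
- have [a b] := zip_letters pu.
  by rewrite (ltnW (um _ a)) (ltnW (um' _ b)).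
- exact: hu.
Qed.

Lemma oiso_join m m' us vs : size us = size vs ->
  (forall i, oiso (nth [::] us i) (nth [::] vs i)) ->
  bounded m us -> bounded m' vs -> increasing us -> increasing vs ->
  oiso (join m us) (join m' vs).
Proof.
move=> s h bu bv iu iv.
(* With the separators in front, the induction also carries the comparison of each remaining letter
   with the separator. *)
suff [s' h'] : oiso (m :: join m us) (m' :: join m' vs).
  case: s' => s'; split=> // p q pz qz; apply: h'; rewrite inE ?pz ?qz orbT //.
elim: us vs s h bu bv iu iv => [|u us IH] [|v vs] //= s h.
  by move=> _ _ _ _; split=> // p q; rewrite !inE => /eqP-> /eqP->; rewrite !leqnn.
rewrite /bounded /increasing /= => /andP[um bu] /andP[vm bv] /andP[uu iu] /andP[vv iv].
case: s => s; have h0 := h 0.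
rewrite /nilp s; case: eqP => [_|_]; first exact: oiso_max.
have [sj hj] := IH vs s (fun i => h i.+1) bu bv iu iv.
have [sc hc] : oiso (u ++ m :: join m us) (v ++ m' :: join m' vs).
  by apply: oiso_cat => //; exact: allrel_join.
(* The pair of separators already occurs further on, so putting it in front adds no new
   comparison. *)
have mm : (m, m') \in zip (u ++ m :: join m us) (v ++ m' :: join m' vs).
  by rewrite zip_cat ?mem_cat /= ?inE ?eqxx ?orbT //; case: h0.
split=> [|p q] /=; first by rewrite sc.
by rewrite !inE => /orP[/eqP->|pz] /orP[/eqP->|qz]; apply: hc.
Qed.

(** The map [f] reads the letter of [v] at the first occurrence of a letter in [u]. By order
    isomorphism any occurrence gives the same value, so [v] is a strictly monotone relabelling of
    [u]. *)
Lemma SC_oiso u v : oiso u v -> SC u = SC v.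
Proof.
move=> [s h]; set f := fun x => nth 0 v (index x u).
have zi i : i < size u -> (nth 0 u i, nth 0 v i) \in zip u v.
  by move=> iu; rewrite -nth_zip // mem_nth // size_zip -s minnn.
have hle : {in u &, forall x y, (f x <= f y) = (x <= y)}.
  move=> x y xu yu.
  have := h _ _ (zi _ (etrans (index_mem x u) xu)) (zi _ (etrans (index_mem y u) yu)).
  by rewrite /= !nth_index.
have -> : v = map f u.
  apply: (@eq_from_nth _ 0); first by rewrite size_map.
  move=> i; rewrite -s => iu; rewrite (nth_map 0) // /f.
  set j := index _ _; have ju : j < size u by rewrite index_mem mem_nth.
  have e : nth 0 u j = nth 0 u i by rewrite nth_index ?mem_nth.
  have /= := h _ _ (zi _ iu) (zi _ ju); have /= := h _ _ (zi _ ju) (zi _ iu).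
  by rewrite e !leqnn => h1 h2; apply/eqP; rewrite eqn_leq -h1 -h2.
rewrite SC_map // => x y xu yu.
by rewrite !ltnNge hle.
Qed.

(** * From trees to words and back *)

(** Children are indexed by [nth], which avoids a membership test on trees; an index out of range
    yields [Leaf], covered by the first case. *)
Lemma tree_nested_ind (P : tree -> Prop) :
  P Leaf ->
  (forall cs, (forall i, P (nth Leaf cs i)) -> P (Node cs)) ->
  forall t, P t.
Proof.
move=> hL hN; fix IH 1 => -[|cs]; first exact: hL.
apply: hN; elim: cs => [|c cs IHcs] [|i];
  [exact: hL | exact: hL | exact: IH | exact: IHcs].
Qed.

Lemma ltree_nested_ind (P : ltree -> Prop) :
  P LLeaf ->
  (forall l cs, (forall i, P (nth LLeaf cs i)) -> P (LNode l cs)) ->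
  forall t, P t.
Proof.
move=> hL hN; fix IH 1 => -[|l cs]; first exact: hL.
apply: hN; elim: cs => [|c cs IHcs] [|i];
  [exact: hL | exact: hL | exact: IH | exact: IHcs].
Qed.

Definition tword (t : tree) : seq nat := blevels (Inc t).1.
Definition theight (t : tree) : nat := (Inc t).2.

Lemma blevels_node l cs : blevels (LNode l cs) = join l (map blevels cs).
Proof. by case: cs => // c cs; rewrite [map _ _]/= joinE -map_comp. Qed.

Lemma join_map f m ws : join (f m) (map (map f) ws) = map f (join m ws).
Proof.
elim: ws => //= w ws IH.
by rewrite /nilp size_map; case: eqP => // _; rewrite map_cat /= IH.
Qed.

Lemma blevels_shift d t : blevels (Defs.lshift d t) = map (addn d) (blevels t).
Proof.
elim/ltree_nested_ind: t => // l cs IH.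
rewrite -[Defs.lshift d _]/(LNode (l + d) (map (Defs.lshift d) cs)) !blevels_node.
rewrite [l + d]addnC -join_map -!map_comp; congr join.
by elim: cs IH => //= c cs IHcs IH; rewrite (IH 0) IHcs // => i; apply: (IH i.+1).
Qed.

Fixpoint shifted_words (off : nat) (cs : seq tree) : seq (seq nat) :=
  match cs with
  | [::] => [::]
  | c :: cs' => map (addn off) (tword c) :: shifted_words (off + theight c) cs'
  end.

Lemma shift_childrenE off cs :
  map blevels (shift_children off (map Inc cs)).1 = shifted_words off cs /\
  (shift_children off (map Inc cs)).2 = off + sumn (map theight cs).
Proof.
elim: cs off => [|c cs IH] off /=; first by rewrite addn0.
have := IH (off + (Inc c).2).
case: (shift_children _ _) => l o /= [-> ->].
by rewrite blevels_shift addnA.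
Qed.

Lemma theight_node cs : theight (Node cs) = (sumn (map theight cs)).+1.
Proof.
rewrite /theight /=; have := (shift_childrenE 0 cs).2.
by case: shift_children => l o /= ->.
Qed.

Lemma tword_node cs :
  tword (Node cs) = join (theight (Node cs)) (shifted_words 0 cs).
Proof.
rewrite /tword /theight /=; have := (shift_childrenE 0 cs).1.
by case: shift_children => l o /= <-; rewrite -blevels_node.
Qed.

Lemma size_shifted_words off cs : size (shifted_words off cs) = size cs.
Proof. by elim: cs off => //= c cs IH off; rewrite IH. Qed.

(** Subtrees occupy consecutive intervals of levels. The hypothesis is the conclusion of [tword_mem]
    on the children, so that the lemma can be used inside the induction proving [tword_mem]. *)
Lemma shifted_words_incr off cs :
  (forall i, tword (nth Leaf cs i) =i iota 1 (theight (nth Leaf cs i))) ->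
  [/\ increasing (shifted_words off cs),
      forall x, (has (mem^~ x) (shifted_words off cs)) =
                (off < x <= off + sumn (map theight cs))
    & forall w, w \in shifted_words off cs ->
        exists2 i, i < size cs & w = map (addn (off + sumn (map theight (take i cs))))
                                     (tword (nth Leaf cs i))].
Proof.
elim: cs off => [|c cs IH] off h /=.
  by split=> // x; lia.
have [iw hw ew] := IH (off + theight c) (fun i => h i.+1).
have h0 : tword c =i iota 1 (theight c) := h 0.
have hc x : (x \in map (addn off) (tword c)) = (off < x <= off + theight c).
  apply/mapP/idP => [[y]|hx]; first by rewrite h0 mem_iota => hy ->; lia.
  by exists (x - off); rewrite ?h0 ?mem_iota; lia.
split.
- rewrite /increasing /= -/(increasing _) iw andbT; apply/allP => w wW.
  apply/allrelP => x y; rewrite hc => hx yw /=.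
  have : has (mem^~ y) (shifted_words (off + theight c) cs) by apply/hasP; exists w.
  by rewrite hw; lia.
- by move=> x; rewrite hw -[in LHS]/(x \in _) hc; lia.
- move=> w; rewrite inE => /orP[/eqP->|/ew[i ic ->]].
    by exists 0 => //=; rewrite addn0.
  by exists i.+1 => //=; rewrite addnA.
Qed.

Lemma has_mem_bounded m ws : (forall x, has (mem^~ x) ws -> x < m) -> bounded m ws.
Proof.
move=> h; apply/allP => w wW; apply/allP => x xw /=; apply: h.
by apply/hasP; exists w.
Qed.

Lemma wf_nth cs i : all wf_tree cs -> wf_tree (nth Leaf cs i).
Proof. by elim: cs i => [|c cs IH] [|i] //= /andP[? ?] //; apply: IH. Qed.

(** A vertex has at least two children, hence a branching of its own, so the top level does occur in
    the word. *)
Lemma tword_mem t : wf_tree t -> tword t =i iota 1 (theight t).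
Proof.
elim/tree_nested_ind: t => // cs IH /= /andP[s wcs] x.
have h i : tword (nth Leaf cs i) =i iota 1 (theight (nth Leaf cs i)).
  exact/IH/wf_nth.
have [_ hw _] := shifted_words_incr 0 h.
rewrite tword_node mem_join hw size_shifted_words s theight_node mem_iota; lia.
Qed.

Section Node.
Variable cs : seq tree.
Hypothesis wcs : all wf_tree cs.

Let h i : tword (nth Leaf cs i) =i iota 1 (theight (nth Leaf cs i)).
Proof. exact/tword_mem/wf_nth. Qed.

Lemma shifted_words_bounded : bounded (theight (Node cs)) (shifted_words 0 cs).
Proof.
have [_ hw _] := shifted_words_incr 0 h.
by apply: has_mem_bounded => x; rewrite hw theight_node; lia.
Qed.

Lemma shifted_words_increasing : increasing (shifted_words 0 cs).
Proof. by have [] := shifted_words_incr 0 h. Qed.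

End Node.

Lemma avoid_tword t : wf_tree t -> avoid (tword t).
Proof.
elim/tree_nested_ind: t => [_ a b c //|cs IH /= /andP[s wcs]].
have h i : tword (nth Leaf cs i) =i iota 1 (theight (nth Leaf cs i)).
  exact/tword_mem/wf_nth.
have [_ _ ew] := shifted_words_incr 0 h.
rewrite tword_node; apply: avoid_join.
- exact: shifted_words_bounded.
- exact: shifted_words_increasing.
move=> w /ew[i _ ->]; apply: avoid_map; last exact/IH/wf_nth.
by move=> x y; rewrite leq_add2l.
Qed.

(** No level is skipped, by [tword_mem], so the range of levels in [sigma] is the sorted list of
    letters. *)
Lemma sigma_Inc t : wf_tree t -> sigma (Inc t).1 (Inc t).2 = SC (tword t).
Proof.
move=> /tword_mem h; rewrite /SC (lettersE (s := iota 1 (theight t))) //.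
  exact: iota_ltn_sorted.
Qed.

Lemma oiso_map (f : nat -> nat) u v :
  {mono f : x y / x <= y} -> oiso u v -> oiso (map f u) v.
Proof.
move=> hf [s h]; split; first by rewrite size_map.
have -> : zip (map f u) v = [seq (f p.1, p.2) | p <- zip u v].
  by elim: u v {s h} => [|x u IH] [|y v] //=; rewrite IH.
by move=> _ _ /mapP[p pz ->] /mapP[q qz ->] /=; rewrite hf; apply: h.
Qed.

Lemma max_mem (w : seq nat) : w != [::] -> \max_(x <- w) x \in w.
Proof.
case: w => // x s _; elim: s x => [|y s IHs] x; first by rewrite big_seq1 inE.
rewrite big_cons; have := IHs y.
case: (leqP x (\max_(j <- y :: s) j)) => _ h.
  by rewrite inE h orbT.
by rewrite inE eqxx.
Qed.

(** This inverts [Inc] up to order isomorphism: by induction on length, the pieces between maximal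
    letters are the words of the subtrees. *)
Lemma avoid_tree w : avoid w -> exists2 t, wf_tree t & oiso (tword t) w.
Proof.
have [n] := ubnP (size w); elim: n w => // n IH w; rewrite ltnS => wn aw.
have [->|w0] := eqVneq w [::]; first by exists Leaf => //; split.
set m := \max_(x <- w) x.
have mw : m \in w by apply: max_mem.
have /join_split[ws [ew bw s0 /(_ mw) s1]] : all (geq m) w.
  by apply/allP => x xw /=; apply: leq_bigmax_seq.
have [iw aws] : increasing ws /\ (forall v, v \in ws -> avoid v).
  by apply: (avoid_join_inv bw); rewrite ew.
(* At least one separator has been removed, so each piece is strictly shorter. *)
have sz v : v \in ws -> size v < n.
  move=> vw; apply: leq_trans wn; rewrite -ew.
  case: ws s1 vw {ew bw s0 iw aws} => // u ws s1.
  rewrite joinE size_cat size_flatten inE => /orP[/eqP->|].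
    by case: ws s1 => //= u' ws _; lia.
  move=> vw; have : size (m :: v) <= sumn (shape [seq m :: v0 | v0 <- ws]).
    elim: ws vw {s1} => //= v0 ws IHw; rewrite inE => /orP[/eqP->|/IHw /=]; lia.
  by move=> /=; lia.
have [cs [scs wcs hcs]] : exists cs, [/\ size cs = size ws, all wf_tree cs &
    forall i, oiso (tword (nth Leaf cs i)) (nth [::] ws i)].
  elim: ws aws sz {ew bw s0 s1 iw} => [|v ws IHw] aws sz.
    by exists [::]; split=> // i; rewrite !nth_nil.
  have [||t wt ht] := IH v.
  - by apply: sz; rewrite inE eqxx.
  - by apply: aws; rewrite inE eqxx.
  have [||cs [s1 s2 s3]] := IHw.
  - by move=> u uw; apply: aws; rewrite inE uw orbT.
  - by move=> u uw; apply: sz; rewrite inE uw orbT.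
  exists (t :: cs); split; rewrite /= ?s1 ?wt //.
  by case=> //= i; apply: s3.
exists (Node cs); first by rewrite /= scs s1.
rewrite tword_node -ew; apply: oiso_join => //.
- by rewrite size_shifted_words.
(* The offset 0 is generalized for the induction; shifting the word of a child keeps it order
   isomorphic to its piece. *)
- elim: cs ws hcs scs {ew bw s0 s1 iw aws sz wcs} 0 => [|c cs IHc] [|v ws] //= hcs scs off i.
    by rewrite !nth_nil.
  case: scs => scs; case: i => [|i] /=; last by apply: (IHc ws (fun i => hcs i.+1) scs).
  by apply: oiso_map (hcs 0) => x y; rewrite leq_add2l.
- exact: shifted_words_bounded.
- exact: shifted_words_increasing.
Qed.

Lemma is_LITP P : is_LIT P <-> exists2 w, avoid w & SC w = P.
Proof.
split=> [[t [wt <-]]|[w aw <-]].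
  by exists (tword t); [exact: avoid_tword | rewrite sigma_Inc].
have [t wt ht] := avoid_tree aw.
by exists t; split=> //; rewrite sigma_Inc //; apply: SC_oiso.
Qed.

Lemma letters_tword t : wf_tree t -> letters (tword t) = iota 1 (theight t).
Proof.
move=> wt; apply: lettersE; first exact: iota_ltn_sorted.
by move=> x; rewrite tword_mem.
Qed.

Lemma theight_tword t1 t2 : wf_tree t1 -> wf_tree t2 ->
  tword t1 = tword t2 -> theight t1 = theight t2.
Proof.
move=> /letters_tword e1 /letters_tword e2 e.
by rewrite -[theight t1](size_iota 1) -e1 e e2 size_iota.
Qed.

Lemma tword_inj t1 t2 : wf_tree t1 -> wf_tree t2 -> tword t1 = tword t2 -> t1 = t2.
Proof.
have nz cs : wf_tree (Node cs) -> tword (Node cs) != [::].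
  move=> /tword_mem h; apply/eqP => e; have := h 1.
  by rewrite e theight_node.
elim/tree_nested_ind: t1 t2 => [|cs IH] [|cs'] //.
- by move=> _ /nz h e; move: h; rewrite -e.
- by move=> /nz h _ e; move: h; rewrite e.
move=> w1 w2 e; congr Node.
(* Equal heights mean that both words are cut at the same letter, as [join_inj] requires. *)
have k := theight_tword w1 w2 e.
move: (w1) (w2) => /= /andP[s1 a1] /andP[s2 a2].
have : shifted_words 0 cs = shifted_words 0 cs'.
  apply: (@join_inj (theight (Node cs))).
  - exact: shifted_words_bounded.
  - by rewrite k; apply: shifted_words_bounded.
  - by rewrite size_shifted_words ltnW.
  - by rewrite size_shifted_words ltnW.
  - by rewrite -tword_node e tword_node k.
elim: cs cs' 0 IH a1 a2 {w1 w2 e k s1 s2} => [|c cs IHc] [|c' cs'] off IH //=.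
move=> /andP[wc wcs] /andP[wc' wcs'] [/(inj_map (@addnI off)) e1 e2].
(* Once the first children agree, so do the offsets of the remaining ones. *)
have ec := IH 0 _ wc wc' e1; subst c'.
congr (_ :: _); apply: IHc e2 => // i; exact: (IH i.+1).
Qed.

(** The composition determines the word: the number of blocks is the height, and each block says
    where its level occurs. *)
Lemma Inc_inj t1 t2 : wf_tree t1 -> wf_tree t2 ->
  sigma (Inc t1).1 (Inc t1).2 = sigma (Inc t2).1 (Inc t2).2 -> t1 = t2.
Proof.
move=> w1 w2; rewrite !sigma_Inc // => e.
apply: tword_inj => //; apply: (@eq_from_nth _ 0).
  by rewrite -!size_SC e.
have s : theight t1 = theight t2.
  by have := congr1 size e; rewrite !size_map !letters_tword // !size_iota.
move=> i it; set j := nth 0 (tword t1) i.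
have jl : j \in iota 1 (theight t1) by rewrite -tword_mem // mem_nth.
have : positions (tword t1) j = positions (tword t2) j.
  move: e; rewrite /SC !letters_tword // -s => /eq_in_map.
  by apply.
move/(congr1 (fun s => i.+1 \in s)); rewrite !mem_positions /= it eqxx.
by move/esym => /andP[_ /eqP].
Qed.

(** * Factorization into generators *)

Lemma sc_size_cat P Q : sc_size (P ++ Q) = sc_size P + sc_size Q.
Proof. by rewrite /sc_size map_cat sumn_cat. Qed.

Lemma sc_size_shift c P : sc_size (map (map (addn c)) P) = sc_size P.
Proof.
by rewrite /sc_size -map_comp; congr sumn; apply: eq_map => b /=; rewrite size_map.
Qed.

Lemma sc_size_mul P Q : sc_size (sc_mul P Q) = sc_size P + sc_size Q.
Proof. by rewrite sc_size_cat sc_size_shift. Qed.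

Lemma sc_mulA : associative sc_mul.
Proof.
move=> P Q S; rewrite [sc_mul P (sc_mul Q S)]/sc_mul map_cat catA [RHS]/sc_mul sc_size_mul.
congr (_ ++ _).
rewrite -!map_comp; apply: eq_map => b /=; rewrite -map_comp.
by apply: eq_map => i /=; rewrite addnA.
Qed.

Lemma sc_mul0 P : sc_mul P [::] = P. Proof. exact: cats0. Qed.

Lemma sc_0mul P : sc_mul [::] P = P.
Proof.
rewrite /sc_mul /=; elim: P => //= b P ->; congr (_ :: _).
by elim: b => //= i b ->.
Qed.

Lemma is_LIT0 : is_LIT [::].
Proof. by exists Leaf. Qed.

Lemma is_LIT_mul P Q : is_LIT P -> is_LIT Q -> is_LIT (sc_mul P Q).
Proof.
move=> /is_LITP[u au <-] /is_LITP[v av <-].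
have [-> h] := sc_mul_SC u v; apply/is_LITP; eexists; last by [].
by apply: avoid_cat => //; apply: avoid_map av => x y; rewrite leq_add2l.
Qed.

Lemma unsh_avoid w d : avoid w -> d \in unsh w -> avoid d.1 /\ avoid d.2.
Proof.
move=> aw /mapP[m _ ->] /=.
by split; apply: avoid_subseq aw; apply: mask_subseq.
Qed.

Lemma is_LIT_delta P d : is_LIT P -> d \in sc_delta P -> is_LIT d.1 /\ is_LIT d.2.
Proof.
move=> /is_LITP[w aw <-]; rewrite sc_delta_SC => /mapP[e /(unsh_avoid aw)[a1 a2] ->].
by split; apply/is_LITP; [exists e.1 | exists e.2].
Qed.

(** Blocks are sorted, so branching 1 lies in the top block: the word starts with its largest
    letter, and the first subtree is trivial. The default 0 excludes the empty composition. *)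
Definition is_gen (P : setcomp) : Prop := is_LIT P /\ head 0 (last [::] P) = 1.

Lemma last_letters (m : nat) v : m \in v -> all (geq m) v ->
  letters v = rcons (letters [seq x <- v | x < m]) m.
Proof.
move=> mv /allP vm; apply: lettersE.
  rewrite (sorted_pairwise ltn_trans) -cats1 pairwise_cat.
  rewrite -(sorted_pairwise ltn_trans) letters_sorted !andbT.
  by apply/allrelP => x y; rewrite mem_letters mem_filter inE => /andP[xm _] /eqP->.
move=> x; rewrite mem_rcons inE mem_letters mem_filter.
case: (eqVneq x m) => [->|xm] /=; first by rewrite mv.
rewrite ltn_neqAle xm /=; case xv: (x \in v); last by rewrite andbF.
by rewrite andbT; apply: (vm _ xv).
Qed.

Lemma max_factor w : avoid w -> w != [::] ->
  exists u v, [/\ w = u ++ v, allrel ltn u v, v != [::], avoid u & is_gen (SC v)].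
Proof.
move=> aw w0; set m := \max_(x <- w) x.
have wm : all (geq m) w by apply/allP => x xw; apply: leq_bigmax_seq.
have [ws [ew bw _ /(_ (max_mem w0)) s1]] := join_split wm.
have [iw aws] : increasing ws /\ (forall v, v \in ws -> avoid v).
  by apply: (avoid_join_inv bw); rewrite ew.
case: ws s1 ew bw iw aws => [|u [|v ws]] //= _ ew /andP[um bw] /andP[iu iw] aws.
exists u, (m :: (join m (v :: ws))); split=> //.
- exact: allrel_join.
- by apply: aws; rewrite inE eqxx.
have jm : all (geq m) (m :: join m (v :: ws)) by rewrite /= leqnn -/(join m (v :: ws)) join_le.
split.
  apply/is_LITP; eexists; last by [].
  by apply: avoid_subseq aw; rewrite -ew suffix_subseq.
rewrite /SC (last_letters _ jm) ?inE ?eqxx // map_rcons last_rcons.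
by rewrite positions_cons eqxx.
Qed.

Definition sc_prod (s : seq setcomp) : setcomp := foldr sc_mul [::] s.

Lemma sc_prod_cat s t : sc_prod (s ++ t) = sc_mul (sc_prod s) (sc_prod t).
Proof. by elim: s => [|P s IH] /=; rewrite ?sc_0mul // IH sc_mulA. Qed.

Lemma LIT_factor P : is_LIT P ->
  exists s, (forall Q, Q \in s -> is_gen Q) /\ P = sc_prod s.
Proof.
move=> /is_LITP[w]; have [n] := ubnP (size w); elim: n w P => // n IH w P.
rewrite ltnS => wn aw <-.
have [->|w0] := eqVneq w [::]; first by exists [::].
have [u [v [ew uv v0 au gv]]] := max_factor aw w0.
have [|s [gs es]] := IH u (SC u) _ au erefl.
  by move: wn v0; rewrite ew size_cat -size_eq0; case: (size v) => // *; lia.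
exists (rcons s (SC v)); split.
  by move=> Q; rewrite mem_rcons inE => /orP[/eqP->|/gs].
by rewrite -cats1 sc_prod_cat /= sc_mul0 -es ew SC_cat.
Qed.

Lemma LIT_blocks P : is_LIT P -> [::] \notin P.
Proof. by move=> /is_LITP[w _ <-]; apply/negP => /SC_block. Qed.

Lemma gen_neq0 P : is_gen P -> P != [::].
Proof. by case: P => // -[]. Qed.

Lemma sc_size_eq0 P : [::] \notin P -> sc_size P = 0 -> P = [::].
Proof. by case: P => // -[|x b] P. Qed.

Lemma LIT_size P : is_LIT P -> P != [::] -> 0 < sc_size P.
Proof.
move=> /LIT_blocks bP; apply: contraR; rewrite -eqn0Ngt => /eqP /(sc_size_eq0 bP) ->.
by [].
Qed.

(** Without empty blocks, longer prefixes have strictly larger total size, so the size fixes where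
    the prefix ends. *)
Lemma sc_prefix_inj (P P' X X' : setcomp) : [::] \notin P -> [::] \notin P' ->
  sc_size P = sc_size P' -> P ++ X = P' ++ X' -> P = P'.
Proof.
elim: P P' => [|b P IH] [|b' P'] // bP bP' s.
- by move=> _; rewrite [RHS](sc_size_eq0 bP').
- by move=> _; rewrite [LHS](sc_size_eq0 bP).
case=> eb e; subst b'; move: bP bP' s; rewrite !inE !negb_or /sc_size /=.
by move=> /andP[_ bP] /andP[_ bP'] /addnI s; rewrite (IH P').
Qed.

(* The last block of a product [P * G] starts at [|P| + 1] when [G] is a
   generator, so the cutting point can be read off the product. *)
Lemma gen_right_inj P G P' G' : [::] \notin P -> [::] \notin P' ->
  is_gen G -> is_gen G' -> sc_mul P G = sc_mul P' G' -> P = P' /\ G = G'.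
Proof.
move=> bP bP' gG gG' e.
have cut Q H : is_gen H -> head 0 (last [::] (sc_mul Q H)) = (sc_size Q).+1.
  move=> [_]; rewrite /sc_mul last_cat; case: H => [|b H] //.
  rewrite /= last_map; case: (last b H) => //= x l ->; by rewrite addn1.
have s : sc_size P = sc_size P' by apply/eqP; rewrite -eqSS -(cut P G) // -(cut P' G') // e.
move: e; rewrite /sc_mul s => e.
have eP := sc_prefix_inj bP bP' s e.
split=> //; move: e; rewrite eP => /eqP; rewrite eqseq_cat // eqxx => /eqP.
apply: inj_map; apply: inj_map; exact: addnI.
Qed.

Lemma sc_prod_LIT s : (forall Q, Q \in s -> is_LIT Q) -> is_LIT (sc_prod s).
Proof.
elim: s => [|P s IH] h; first exact: is_LIT0.
apply: is_LIT_mul; first by apply: h; rewrite inE eqxx.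
by apply: IH => Q Qs; apply: h; rewrite inE Qs orbT.
Qed.

Lemma sc_prod_inj s t : (forall Q, Q \in s -> is_gen Q) ->
  (forall Q, Q \in t -> is_gen Q) -> sc_prod s = sc_prod t -> s = t.
Proof.
have nz (u : seq setcomp) G : is_gen G -> sc_prod (rcons u G) != [::].
  move=> /gen_neq0; rewrite -cats1 sc_prod_cat /= sc_mul0 /sc_mul.
  by case: (sc_prod u) => //; case: G.
elim/last_ind: s t => [|s G IH] t; case/lastP: t => [|t G'] // gs gt.
- by move/esym/eqP; rewrite (negPf (nz _ _ _)) //; apply: gt; rewrite mem_rcons inE eqxx.
- by move/eqP; rewrite (negPf (nz _ _ _)) //; apply: gs; rewrite mem_rcons inE eqxx.
have gs' Q : Q \in s -> is_gen Q by move=> Qs; apply: gs; rewrite mem_rcons inE Qs orbT.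
have gt' Q : Q \in t -> is_gen Q by move=> Qs; apply: gt; rewrite mem_rcons inE Qs orbT.
rewrite -!cats1 !sc_prod_cat /= !sc_mul0 => /gen_right_inj[].
- by apply/LIT_blocks/sc_prod_LIT => Q /gs' [].
- by apply/LIT_blocks/sc_prod_LIT => Q /gt' [].
- by apply: gs; rewrite mem_rcons inE eqxx.
- by apply: gt; rewrite mem_rcons inE eqxx.
by move=> /IH -> // ->.
Qed.

(** * Linear combinations and free generation *)

Import GRing.Theory.
Local Open Scope ring_scope.

Section Eval.
Variables (R : comNzRingType) (K : eqType).
Implicit Types (x y : seq (R * K)) (f g : K -> R).

(** The linear extension of [f]. Equality of combinations becomes equality against all [f], which
    turns algebraic identities into manipulations of nested sums. *)
Definition ev x f : R := \sum_(p <- x) p.1 * f p.2.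

Lemma ev_nil f : ev [::] f = 0. Proof. exact: big_nil. Qed.

Lemma ev_cons p x f : ev (p :: x) f = p.1 * f p.2 + ev x f.
Proof. exact: big_cons. Qed.

Lemma ev_cat x y f : ev (x ++ y) f = ev x f + ev y f.
Proof. exact: big_cat. Qed.

Lemma eq_ev x f g : f =1 g -> ev x f = ev x g.
Proof. by move=> fg; apply: eq_bigr => p _; rewrite fg. Qed.

Lemma eq_in_ev x f g : (forall p, p \in x -> f p.2 = g p.2) -> ev x f = ev x g.
Proof. by move=> fg; apply: eq_big_seq => p px; rewrite fg. Qed.

Lemma ev_add x f g : ev x (fun k => f k + g k) = ev x f + ev x g.
Proof. by rewrite -big_split; apply: eq_bigr => p _; rewrite mulrDr. Qed.

Lemma ev_mull x a f : ev x (fun k => a * f k) = a * ev x f.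
Proof. by rewrite mulr_sumr; apply: eq_bigr => p _; rewrite mulrCA. Qed.

Lemma ev_sum (J : Type) (r : seq J) x (f : J -> K -> R) :
  ev x (fun k => \sum_(j <- r) f j k) = \sum_(j <- r) ev x (f j).
Proof.
rewrite /ev exchange_big; apply: eq_bigr => p _; by rewrite mulr_sumr.
Qed.

Lemma sum_ev (J : Type) (r : seq J) (F : J -> seq (R * K)) f :
  ev (flatten [seq F j | j <- r]) f = \sum_(j <- r) ev (F j) f.
Proof. by rewrite /ev big_flatten big_map. Qed.

Lemma ev_coef_eq x y :
  (forall k, \sum_(p <- x | p.2 == k) p.1 = \sum_(p <- y | p.2 == k) p.1) ->
  forall f, ev x f = ev y f.
Proof.
move=> h f; pose r := undup (map snd x ++ map snd y).
suff evE z : {subset map snd z <= r} ->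
    ev z f = \sum_(k <- r) (\sum_(p <- z | p.2 == k) p.1) * f k.
  rewrite !evE; try by move=> k kx; rewrite mem_undup mem_cat kx ?orbT.
  by apply: eq_bigr => k _; rewrite h.
move=> zr; under [RHS]eq_bigr => k _ do rewrite mulr_suml big_mkcond /=.
rewrite exchange_big /=; apply: eq_big_seq => p pz.
have pr : p.2 \in r by apply: zr; apply: map_f.
rewrite (bigD1_seq p.2) ?undup_uniq //= eqxx big1 ?addr0 // => k /negPf kp.
by rewrite eq_sym kp.
Qed.

Lemma coef_ev x k : \sum_(p <- x | p.2 == k) p.1 = ev x (fun l => (l == k)%:R).
Proof. by rewrite big_mkcond; apply: eq_bigr => p _; case: eqP => _; rewrite ?mulr1 ?mulr0. Qed.

End Eval.

Section LinComb.
Variable R : comNzRingType.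
Implicit Types (x y z : lc R) (f : setcomp -> R).

Lemma lc_eqP x y : lc_eq x y <-> forall f, ev x f = ev y f.
Proof.
split=> [h|h P]; first exact: ev_coef_eq.
by rewrite /coef !coef_ev.
Qed.

Lemma ev_scale a x f : ev (lc_scale a x) f = a * ev x f.
Proof. by rewrite /ev big_map mulr_sumr; apply: eq_bigr => p _; rewrite mulrA. Qed.

Lemma ev_mul x y f :
  ev (lc_mul x y) f = ev x (fun P => ev y (fun Q => f (sc_mul P Q))).
Proof.
rewrite /ev big_allpairs_dep; apply: eq_bigr => p _.
by rewrite mulr_sumr; apply: eq_bigr => q _; rewrite mulrA.
Qed.

Lemma ev_one f : ev (lc_one R) f = f [::].
Proof. by rewrite /ev big_seq1 mul1r. Qed.

Lemma ev_delta x (F : setcomp * setcomp -> R) :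
  ev (lc_delta x) F = ev x (fun P => \sum_(d <- sc_delta P) F d).
Proof.
rewrite /ev big_allpairs_dep; apply: eq_bigr => p _.
by rewrite mulr_sumr.
Qed.

Lemma ev_antipode x f :
  ev (lc_antipode x) f = ev x (fun P => ev (antip R (sc_size P) P) f).
Proof. by rewrite sum_ev; apply: eq_bigr => p _; rewrite ev_scale. Qed.

Definition LIT_supported x := forall p, p \in x -> is_LIT p.2.

Lemma supported_mul x y :
  LIT_supported x -> LIT_supported y -> LIT_supported (lc_mul x y).
Proof. by move=> hx hy p /allpairsP[[a b] /= [/hx ha /hy hb ->]]; apply: is_LIT_mul. Qed.

Lemma supported_scale a x : LIT_supported x -> LIT_supported (lc_scale a x).
Proof. by move=> hx p /mapP[q /hx hq ->]. Qed.

Lemma supported_basis a P : is_LIT P -> LIT_supported [:: (a, P)].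
Proof. by move=> hP p; rewrite inE => /eqP->. Qed.

Lemma supported_flatten (J : eqType) (r : seq J) (F : J -> lc R) :
  (forall j, j \in r -> LIT_supported (F j)) ->
  LIT_supported (flatten [seq F j | j <- r]).
Proof. by move=> h p /flatten_mapP[j /h]; apply. Qed.

Lemma in_LIT_supported x : LIT_supported x -> in_LIT x.
Proof. by move=> h; exists x. Qed.

Lemma in_LIT_one : in_LIT (lc_one R).
Proof. exact/in_LIT_supported/supported_basis/is_LIT0. Qed.

Lemma in_LIT_mul x y : in_LIT x -> in_LIT y -> in_LIT (lc_mul x y).
Proof.
move=> [x' [sx /lc_eqP ex]] [y' [sy /lc_eqP ey]]; exists (lc_mul x' y').
split; first exact: supported_mul.
apply/lc_eqP => f; rewrite !ev_mul ex; apply: eq_ev => P; exact: ey.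
Qed.

Lemma in_LIT_delta x : in_LIT x -> in_LIT2 (lc_delta x).
Proof.
move=> [y [sy /lc_eqP ey]]; exists (lc_delta y); split.
  by move=> p /allpairsPdep[a [b [/sy ha hb ->]]]; apply: (is_LIT_delta ha hb).
by move=> d; rewrite /coef2 !coef_ev !ev_delta.
Qed.

(** The recursion uses only components of the coproduct and products, so any amount of fuel stays
    within the span. *)
Lemma supported_antip n P : is_LIT P -> LIT_supported (antip R n P).
Proof.
elim: n P => [|n IH] P hP /=; case: eqP => _ //; try exact/supported_basis/is_LIT0.
apply: supported_scale; apply: supported_flatten => d.
rewrite mem_filter => /andP[_ /(is_LIT_delta hP)[h1 h2]].
by apply: supported_mul; [exact: IH | exact: supported_basis].
Qed.

Lemma in_LIT_antipode x : in_LIT x -> in_LIT (lc_antipode x).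
Proof.
move=> [y [sy /lc_eqP ey]]; exists (lc_antipode y); split.
  apply: supported_flatten => p /sy hp.
  by apply: supported_scale; apply: supported_antip.
by apply/lc_eqP => f; rewrite !ev_antipode.
Qed.

Section Span.
Variables (I : Type) (g : I -> lc R).

Lemma ev_comb c f :
  ev (lc_comb g c) f = \sum_(p <- c) p.1 * ev (word_prod g p.2) f.
Proof. by rewrite sum_ev; apply: eq_bigr => p _; rewrite ev_scale. Qed.

Lemma ev_word_cat v w f :
  ev (word_prod g (v ++ w)) f =
  ev (word_prod g v) (fun P => ev (word_prod g w) (fun Q => f (sc_mul P Q))).
Proof.
elim: v f => [|i v IH] f /=.
  by rewrite ev_one; apply: eq_ev => P; rewrite sc_0mul.
rewrite !ev_mul; apply: eq_ev => P; rewrite IH.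
by apply: eq_ev => Q; apply: eq_ev => S; rewrite sc_mulA.
Qed.

Definition spanned x := exists c, lc_eq x (lc_comb g c).

Lemma spanned_eq x y : lc_eq x y -> spanned x -> spanned y.
Proof. by move=> e [c hc]; exists c => P; rewrite -e. Qed.

Lemma spanned_nil : spanned [::].
Proof. by exists [::]. Qed.

Lemma spanned_one : spanned (lc_one R).
Proof.
exists [:: (1, [::])]; apply/lc_eqP => f.
by rewrite ev_comb big_seq1 mul1r.
Qed.

Lemma spanned_gen i : spanned (g i).
Proof.
exists [:: (1, [:: i])]; apply/lc_eqP => f.
rewrite ev_comb big_seq1 mul1r /= ev_mul; apply: eq_ev => P.
by rewrite ev_one sc_mul0.
Qed.

Lemma spanned_cat x y : spanned x -> spanned y -> spanned (x ++ y).
Proof.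
move=> [c /lc_eqP hc] [d /lc_eqP hd]; exists (c ++ d); apply/lc_eqP => f.
by rewrite ev_cat hc hd !ev_comb big_cat.
Qed.

Lemma spanned_scale a x : spanned x -> spanned (lc_scale a x).
Proof.
move=> [c /lc_eqP hc]; exists [seq (a * p.1, p.2) | p <- c]; apply/lc_eqP => f.
rewrite ev_scale hc !ev_comb big_map mulr_sumr.
by apply: eq_bigr => p _; rewrite mulrA.
Qed.

Lemma spanned_mul x y : spanned x -> spanned y -> spanned (lc_mul x y).
Proof.
move=> [c /lc_eqP hc] [d /lc_eqP hd].
exists [seq (p.1 * q.1, p.2 ++ q.2) | p <- c, q <- d]; apply/lc_eqP => f.
rewrite ev_mul hc !ev_comb big_allpairs_dep /=; apply: eq_bigr => p _.
rewrite (eq_ev _ (fun P => hd _)).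
rewrite (eq_ev _ (fun P => ev_comb _ _)) ev_sum mulr_sumr; apply: eq_bigr => q _.
by rewrite ev_mull ev_word_cat mulrA.
Qed.

Lemma spanned_terms x : (forall p, p \in x -> spanned [:: (1, p.2)]) -> spanned x.
Proof.
elim: x => [|[a P] x IH] hx; first exact: spanned_nil.
apply: (@spanned_cat [:: (a, P)]); last first.
  by apply: IH => p px; apply: hx; rewrite inE px orbT.
have /(spanned_scale a) : spanned [:: (1, P)] by apply: (hx (a, P)); rewrite inE eqxx.
by rewrite /lc_scale /= mulr1.
Qed.

End Span.

Definition gen : eqType := {P : setcomp | `[< is_gen P >]}.

Lemma genP (i : gen) : is_gen (val i).
Proof. by case: i => P /= /asboolP. Qed.

Definition gen_prod (s : seq gen) : setcomp := sc_prod (map val s).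

Lemma gen_prod_cat s t : gen_prod (s ++ t) = sc_mul (gen_prod s) (gen_prod t).
Proof. by rewrite /gen_prod map_cat sc_prod_cat. Qed.

Lemma LIT_gen_prod P : is_LIT P -> exists s, P = gen_prod s.
Proof.
move=> /LIT_factor[s [gs ->]]; elim: s gs => [|Q s IH] gs; first by exists [::].
have [|t /= ->] := IH; first by move=> S Ss; apply: gs; rewrite inE Ss orbT.
have gQ : `[< is_gen Q >] by apply/asboolP; apply: gs; rewrite inE eqxx.
by exists (exist _ Q gQ :: t).
Qed.

Lemma gen_prod_LIT s : is_LIT (gen_prod s).
Proof. by apply: sc_prod_LIT => Q /mapP[i _ ->]; case: (genP i). Qed.

Lemma gen_prod_inj : injective gen_prod.
Proof.
move=> s t /sc_prod_inj h; apply: (inj_map val_inj); apply: h;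
  by move=> Q /mapP[i _ ->]; apply: genP.
Qed.

(** The filtration by number of generator factors, which is well defined by [gen_prod_inj]. *)
Definition length_ge n x := forall p, p \in x -> exists2 s, (n <= size s)%N & p.2 = gen_prod s.

Lemma length_ge_coef n x s : length_ge n x -> (size s < n)%N ->
  ev x (fun P => (P == gen_prod s)%:R) = 0.
Proof.
move=> hx sn; apply: big1_seq => p /= /hx[t nt ->].
rewrite (inj_eq gen_prod_inj); case: eqP => [e|_]; last by rewrite mulr0.
by move: sn; rewrite -e ltnNge nt.
Qed.

Lemma length_ge_mul m n x y :
  length_ge m x -> length_ge n y -> length_ge (m + n) (lc_mul x y).
Proof.
move=> hx hy p /allpairsP[[a b] /= [/hx[s ms es] /hy[t nt et] ->]] /=.
by exists (s ++ t); rewrite ?gen_prod_cat ?es ?et // size_cat leq_add.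
Qed.

Lemma length_geW m n x : (m <= n)%N -> length_ge n x -> length_ge m x.
Proof. by move=> mn h p /h[s ns e]; exists s => //; apply: leq_trans ns. Qed.

Lemma length_ge1 x : LIT_supported x -> (forall p, p \in x -> p.2 != [::]) ->
  length_ge 1 x.
Proof.
move=> sx nx p px; have [s e] := LIT_gen_prod (sx p px); exists s => //.
by have := nx p px; rewrite e; case: (s).
Qed.

(** * Families triangular for the number of factors *)

Section Triangular.
Variables (g r : gen -> lc R).
Hypothesis gE : forall i, g i = (1, val i) :: r i.
Hypothesis rge : forall i, length_ge 2 (r i).

Lemma gen_length_ge i : length_ge 1 (g i).
Proof.
rewrite gE => p; rewrite inE => /orP[/eqP->|/(length_geW (leqnSn 1) (@rge i))//].
by exists [:: i] => //=; rewrite /gen_prod /= sc_mul0.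
Qed.

Lemma word_length_ge w : length_ge (size w) (word_prod g w).
Proof.
elim: w => [|i w IH] /=.
  by move=> p; rewrite inE => /eqP->; exists [::].
exact: (length_ge_mul (@gen_length_ge i) IH).
Qed.

(** In the product along [w], only the product of the leading terms has as few as [size w] factors,
    and it equals [gen_prod w]. *)
Lemma word_coef v w : (size v <= size w)%N ->
  ev (word_prod g w) (fun P => (P == gen_prod v)%:R) = (w == v)%:R.
Proof.
elim: w v => [|i w IH] v.
  rewrite leqn0 size_eq0 => /eqP ->; by rewrite ev_one !eqxx.
rewrite leq_eqVlt => /orP[/eqP sv|sv]; last first.
  rewrite (length_ge_coef (@word_length_ge _)) //.
  by case: eqP sv => // ->; rewrite ltnn.
case: v sv => // j v [] sv.
rewrite [word_prod _ _]/= ev_mul gE ev_cons mul1r.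
rewrite -(ev_mul (r i) (word_prod g w) (fun P => (P == gen_prod (j :: v))%:R)).
(* Terms through [r i] have at least [2 + size w] factors, whereas [j :: v] has length
   [1 + size w]. *)
rewrite [X in _ + X](@length_ge_coef (2 + size w)) ?addr0; last 2 first.
- exact: length_ge_mul (@rge i) (@word_length_ge w).
- by rewrite /= sv; lia.
rewrite eqseq_cons -mulnb natrM -IH ?sv // -ev_mull; apply: eq_in_ev => p.
move=> /word_length_ge[s _ ->].
rewrite -[sc_mul _ _]/(gen_prod (i :: s)) !(inj_eq gen_prod_inj).
by rewrite eqseq_cons -natrM mulnb.
Qed.

(** By induction on the length of [p.2]: at its leading product, other words at least as long
    contribute nothing, and shorter words already have coefficient zero. *)
Lemma triangular_free c : uniq (map snd c) -> lc_eq (lc_comb g c) [::] ->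
  forall p, p \in c -> p.1 = 0.
Proof.
move=> uc /lc_eqP c0 p; have [n] := ubnP (size p.2); elim: n p => // n IH p.
rewrite ltnS => pn pc.
have := c0 (fun P => (P == gen_prod p.2)%:R).
rewrite ev_nil ev_comb (big_rem p) //= word_coef // eqxx mulr1.
rewrite big1_seq ?addr0 // => q /andP[_ qr].
have qc : q \in c by apply: mem_rem qr.
have qp : q.2 != p.2.
  apply/eqP => e; have := uc; rewrite (perm_uniq (perm_map snd (perm_to_rem pc))) /=.
  by rewrite -e map_f.
have [le|lt] := leqP (size p.2) (size q.2).
  by rewrite word_coef // (negPf qp) mulr0.
by rewrite IH ?mul0r //; apply: leq_trans lt pn.
Qed.

Hypothesis r_homogeneous : forall i p, p \in r i -> sc_size p.2 = sc_size (val i).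

(** By induction on degree: a product of two or more generators splits into factors of smaller
    degree, and a single generator is [g i] minus [r i], whose terms are such products in the same
    degree. *)
Lemma triangular_spans P : is_LIT P -> spanned g [:: (1, P)].
Proof.
have [n] := ubnP (sc_size P); elim: n P => // n IH P; rewrite ltnS => Pn hP.
have span2 s : (1 < size s)%N -> (sc_size (gen_prod s) <= n)%N ->
    spanned g [:: (1, gen_prod s)].
  case: s => [|i [|j s]] // _; set t := j :: s => sn.
  have gi := genP i; have gj := genP j.
  have si : (0 < sc_size (val i))%N by apply: LIT_size (gen_neq0 gi); case: gi.
  have st : (0 < sc_size (gen_prod t))%N.
    rewrite sc_size_mul ltn_addr //.
    by apply: LIT_size (gen_neq0 gj); case: gj.
  move: sn; rewrite [gen_prod _]/(sc_mul (val i) (gen_prod t)) sc_size_mul => sn.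
  have hi : spanned g [:: (1, val i)] by apply: IH; [lia | case: gi].
  have ht : spanned g [:: (1, gen_prod t)] by apply: IH; [lia | exact: gen_prod_LIT].
  apply: spanned_eq (spanned_mul hi ht) => Q.
  by rewrite /lc_mul /= mulr1.
case/LIT_gen_prod: hP Pn => -[|i [|j s]] -> Pn; first exact: spanned_one.
  have e1 : gen_prod [:: i] = val i by exact: sc_mul0.
  rewrite e1 in Pn *.
  have hr : spanned g (r i).
    apply: spanned_terms => p pr; have [s s2 e] := rge pr.
    by rewrite e; apply: span2 => //; rewrite -e (r_homogeneous pr).
  apply: spanned_eq (spanned_cat (spanned_gen g i) (spanned_scale (-1) hr)).
  apply/lc_eqP => f; rewrite ev_cat ev_scale gE !ev_cons ev_nil; ring.
exact: span2.
Qed.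

Lemma triangular_freely_generates : freely_generates g.
Proof.
split.
- move=> i; apply: in_LIT_supported => p; rewrite gE inE => /orP[/eqP->|/rge[s _ ->]].
    by case: (genP i).
  exact: gen_prod_LIT.
- move=> x [y [sy exy]].
  have [c hc] : spanned g y by apply: spanned_terms => p /sy; apply: triangular_spans.
  by exists c => P; rewrite exy.
- exact: triangular_free.
Qed.

End Triangular.

Lemma generators_freely_generate : freely_generates (fun i : gen => [:: (1 : R, val i)]).
Proof. exact: (triangular_freely_generates (r := fun=> [::])). Qed.

End LinComb.

(** * Primitive generators *)

Section Dynkin.
Variable R : comNzRingType.

(** The coproduct of a word in Sweedler form, tested against [F]. *)
Definition unsh_sum (w : seq nat) (F : seq nat -> seq nat -> R) : R :=
  \sum_(d <- unsh w) F d.1 d.2.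

Lemma eq_unsh_sum w F G : (forall a b, F a b = G a b) -> unsh_sum w F = unsh_sum w G.
Proof. by move=> h; apply: eq_bigr => d _. Qed.

Lemma unsh_sum_nil F : unsh_sum [::] F = F [::] [::].
Proof. exact: big_seq1. Qed.

Lemma unsh_sum_cons x w F : unsh_sum (x :: w) F =
  unsh_sum w (fun a b => F (x :: a) b) + unsh_sum w (fun a b => F a (x :: b)).
Proof. by rewrite /unsh_sum unsh_cons big_cat !big_map. Qed.

Lemma unsh_sumD w F G : unsh_sum w (fun a b => F a b + G a b) =
  unsh_sum w F + unsh_sum w G.
Proof. exact: big_split. Qed.

(** Cocommutativity: each letter is free to go to either side. *)
Lemma unsh_sumC w F : unsh_sum w F = unsh_sum w (fun a b => F b a).
Proof.
elim: w F => [|x w IH] F; first by rewrite !unsh_sum_nil.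
by rewrite !unsh_sum_cons addrC IH [in X in _ + X]IH.
Qed.

(** Coassociativity: both sides run over the splittings of [w] into three complementary subwords. *)
Lemma unsh_sumA w (G : seq nat -> seq nat -> seq nat -> R) :
  unsh_sum w (fun a c => unsh_sum a (fun a1 a2 => G a1 a2 c)) =
  unsh_sum w (fun a c => unsh_sum c (fun c1 c2 => G a c1 c2)).
Proof.
elim: w G => [|x w IH] G; first by rewrite !unsh_sum_nil.
rewrite !unsh_sum_cons.
rewrite (eq_unsh_sum _ (fun a c => unsh_sum_cons x a _)) unsh_sumD.
rewrite [in RHS](eq_unsh_sum _ (fun a c => unsh_sum_cons x c _)) unsh_sumD.
by rewrite !IH addrA.
Qed.

Lemma unsh_sum_cat u v F : unsh_sum (u ++ v) F =
  unsh_sum u (fun a b => unsh_sum v (fun c d => F (a ++ c) (b ++ d))).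
Proof.
elim: u F => [|x u IH] F; first by rewrite unsh_sum_nil.
by rewrite /= !unsh_sum_cons !IH.
Qed.

Lemma unsh_subseq w d : d \in unsh w -> subseq d.1 w /\ subseq d.2 w.
Proof. by move=> /mapP[m _ ->]; rewrite !mask_subseq. Qed.

Lemma size_unsh w d : d \in unsh w -> (size d.1 + size d.2)%N = size w.
Proof.
elim: w d => [|x w IH] d; first by rewrite inE => /eqP->.
by rewrite unsh_cons mem_cat => /orP[] /mapP[e /IH he ->] /=; rewrite ?addnS ?addSn he.
Qed.

Lemma unsh_sum_left_nil w (F : seq nat -> seq nat -> R) :
  \sum_(d <- unsh w | d.1 == [::]) F d.1 d.2 = F [::] w.
Proof.
elim: w F => [|x w IH] F; first by rewrite big_mkcond big_seq1.
rewrite unsh_cons big_cat 2!big_map /= big_pred0 // add0r.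
exact: (IH (fun a b => F a (x :: b))).
Qed.

Lemma allrel_subseq (u v a c : seq nat) : subseq a u -> subseq c v ->
  allrel ltn u v -> allrel ltn a c.
Proof.
move=> /mem_subseq au /mem_subseq cv /allrelP h.
by apply/allrelP => x y /au xu /cv; apply: h.
Qed.

(** Multiplicativity of the coproduct: splitting a concatenation means splitting each factor, and
    subwords of separated words remain separated. *)
Lemma delta_mul u v (F : setcomp * setcomp -> R) :
  \sum_(d <- sc_delta (sc_mul (SC u) (SC v))) F d =
  \sum_(d <- sc_delta (SC u)) \sum_(e <- sc_delta (SC v))
     F (sc_mul d.1 e.1, sc_mul d.2 e.2).
Proof.
have [-> uv] := sc_mul_SC u v; move: uv; set c := (\max_(x <- u) x).+1 => uv.
have shift : SC v = SC (map (addn c) v).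
  by rewrite SC_map // => x y _ _; rewrite ltn_add2l.
rewrite shift; move: (map _ v) uv => {shift}v uv.
rewrite !sc_delta_SC big_map [RHS]big_map /=.
rewrite -[LHS]/(unsh_sum (u ++ v) (fun a b => F (SC a, SC b))) unsh_sum_cat.
apply: eq_big_seq => d /unsh_subseq[d1 d2]; rewrite big_map /=.
apply: eq_big_seq => e /unsh_subseq[e1 e2].
by rewrite !SC_cat //; apply: allrel_subseq uv.
Qed.

(* The Dynkin operator [S * Y] ([Y] the degree operator), computed from the
   recursion [Y = id * (S * Y)]; [n] is fuel. *)
Fixpoint dynkin_rec (n : nat) (w : seq nat) : lc R :=
  ((size w)%:R, SC w) ::
  if n is n'.+1 then
    flatten [seq lc_mul [:: (-1, SC d.1)] (dynkin_rec n' d.2)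
            | d <- unsh w & (d.1 != [::]) && (d.2 != [::])]
  else [::].

Definition dynkin w := dynkin_rec (size w) w.

Definition dynkin_tail w : lc R :=
  flatten [seq lc_mul [:: (-1, SC d.1)] (dynkin d.2)
          | d <- unsh w & (d.1 != [::]) && (d.2 != [::])].

Lemma unsh_proper w d : d \in unsh w -> d.1 != [::] -> (size d.2 < size w)%N.
Proof. by move=> /size_unsh <-; rewrite -size_eq0; lia. Qed.

Lemma dynkin_fuel n w : (size w <= n)%N -> dynkin_rec n w = dynkin w.
Proof.
suff h m k v : (size v <= m)%N -> (size v <= k)%N -> dynkin_rec m v = dynkin_rec k v.
  by move=> wn; apply: h.
elim: m k v => [|m IH] [|k] v //=.
- by rewrite leqn0 size_eq0 => /eqP->.
- by move=> _; rewrite leqn0 size_eq0 => /eqP->.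
move=> vm vk; congr (_ :: flatten _); apply/eq_in_map => d.
rewrite mem_filter => /andP[/andP[d1 _] /unsh_proper/(_ d1) dv].
by rewrite (IH k) //; rewrite -ltnS; apply: leq_trans dv _.
Qed.

Lemma dynkinE w : dynkin w = ((size w)%:R, SC w) :: dynkin_tail w.
Proof.
rewrite /dynkin /dynkin_tail; case: w => // x w; rewrite [size _]/=.
rewrite [LHS]/=; congr (_ :: flatten _); apply/eq_in_map => d.
rewrite mem_filter => /andP[/andP[d1 _] /unsh_proper/(_ d1) dv].
by rewrite dynkin_fuel.
Qed.

Lemma ev_dynkin_nil f : ev (dynkin [::]) f = 0.
Proof. by rewrite dynkinE ev_cons mul0r add0r; apply: ev_nil. Qed.

(** This is [id * D = Y]. The empty left part contributes [dynkin w], whose tail cancels all proper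
    splittings; the empty right part contributes zero. *)
Lemma dynkin_convolution w f :
  unsh_sum w (fun a b => ev (dynkin b) (fun Q => f (sc_mul (SC a) Q))) =
  (size w)%:R * f (SC w).
Proof.
rewrite /unsh_sum (bigID (fun d => d.1 == [::])) /=.
rewrite (unsh_sum_left_nil w (fun a b => ev (dynkin b) (fun Q => f (sc_mul (SC a) Q)))).
rewrite (@eq_ev _ _ _ _ f); last by move=> Q; rewrite SC_nil sc_0mul.
rewrite dynkinE ev_cons sum_ev big_filter -addrA [X in _ + X](_ : _ = 0) ?addr0 //.
rewrite [X in X + _]big_mkcondr /= -big_split /= big1 // => d d1.
rewrite ev_mul ev_cons ev_nil addr0 mulN1r.
case: eqP => [->|_]; last by rewrite addNr.
by rewrite ev_dynkin_nil add0r.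
Qed.

Lemma dynkin_supported w : avoid w -> w != [::] ->
  forall p, p \in dynkin w -> [/\ is_LIT p.2, p.2 != [::] & sc_size p.2 = size w].
Proof.
have [n] := ubnP (size w); elim: n w => // n IH w; rewrite ltnS => wn aw w0 p.
rewrite dynkinE inE => /orP[/eqP->|].
  by rewrite SC_eq0 size_SC; split=> //; apply/is_LITP; exists w.
case/flatten_mapP => d; rewrite mem_filter => /andP[/andP[d1 d2] dw].
have [a1 a2] := unsh_avoid aw dw.
case/allpairsP => -[a b] /= [] /[!inE] /eqP-> hb -> /=.
have [h1 h2 h3] := IH _ (leq_trans (unsh_proper dw d1) wn) a2 d2 _ hb.
split.
- by apply: is_LIT_mul => //; apply/is_LITP; exists d.1.
- by move: d1; rewrite -SC_eq0 /sc_mul; case: (SC d.1).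
- by rewrite sc_size_mul size_SC h3 (size_unsh dw).
Qed.

(** Each term is a product of two non-empty left increasing compositions, each with at least one
    generator factor. *)
Lemma dynkin_tail_length w : avoid w -> length_ge 2 (dynkin_tail w).
Proof.
move=> aw p /flatten_mapP[d]; rewrite mem_filter => /andP[/andP[d1 d2] dw].
have [a1 a2] := unsh_avoid aw dw; apply: (@length_ge_mul _ 1 1).
  apply: length_ge1 => q; rewrite inE => /eqP->; last by rewrite SC_eq0.
  by apply/is_LITP; exists d.1.
by apply: length_ge1 => q /(dynkin_supported a2 d2)[].
Qed.

(** The coproduct is applied to [id * D = Y], by induction on length. All summands but [dynkin w]
    involve shorter words, whose images are primitive; since [Y] is a coderivation, the remaining
    summand must be primitive too. *)
Lemma dynkin_primitive w : avoid w -> primitive (dynkin w).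
Proof.
move=> aw [A B]; rewrite /coef2 !coef_ev ev_delta ev_cat.
pose F P Q : R := ((P, Q) == (A, B))%:R.
rewrite (_ : ev [seq (p.1, (p.2, [::])) | p <- _] _ =
    ev (dynkin w) (fun Q => F Q [::])); last by rewrite /ev big_map.
rewrite (_ : ev [seq (p.1, ([::], p.2)) | p <- _] _ =
    ev (dynkin w) (fun Q => F [::] Q)); last by rewrite /ev big_map.
rewrite -ev_add (@eq_ev _ _ _ _ (fun P => \sum_(d <- sc_delta P) F d.1 d.2)); last first.
  by move=> P; apply: eq_bigr => -[].
move: F => F {A B}.
have [n] := ubnP (size w); elim: n w aw F => // n IH w aw F; rewrite ltnS => wn.
pose H P := \sum_(d <- sc_delta P) F d.1 d.2.
(* The value at [F] of the coproduct of [SC u] times [dynkin v], computed as if [dynkin v] were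
   primitive. *)
pose X u v := unsh_sum u (fun a b =>
  ev (dynkin v) (fun Q => F (sc_mul (SC a) Q) (SC b)) +
  ev (dynkin v) (fun Q => F (SC a) (sc_mul (SC b) Q))).
have HX d : d \in unsh w -> d.1 != [::] ->
    ev (dynkin d.2) (fun Q => H (sc_mul (SC d.1) Q)) = X d.1 d.2.
  move=> dw d1; have [a1 a2] := unsh_avoid aw dw.
  case: (eqVneq d.2 [::]) => [->|d2].
    rewrite ev_dynkin_nil /X /unsh_sum big1 // => e _.
    by rewrite !ev_dynkin_nil addr0.
  rewrite (@eq_in_ev _ _ _ _ (fun Q => \sum_(d' <- sc_delta (SC d.1))
      \sum_(e <- sc_delta Q) F (sc_mul d'.1 e.1) (sc_mul d'.2 e.2))); last first.
    move=> p /(dynkin_supported a2 d2)[/is_LITP[v _ <-] _ _].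
    exact: (delta_mul d.1 v (fun d => F d.1 d.2)).
  rewrite ev_sum sc_delta_SC big_map; apply: eq_bigr => e _ /=.
  rewrite (IH _ a2 (fun P Q => F (sc_mul (SC e.1) P) (sc_mul (SC e.2) Q))
    (leq_trans (unsh_proper dw d1) wn)) ev_add.
  by congr (_ + _); apply: eq_ev => Q; rewrite sc_mul0.
have X0 : X [::] w = ev (dynkin w) (fun Q => F Q [::] + F [::] Q).
  rewrite /X unsh_sum_nil -ev_add; apply: eq_ev => Q.
  by rewrite SC_nil !sc_0mul.
have sumX : unsh_sum w X = (size w)%:R * H (SC w).
  (* [Y] is a coderivation: the degrees of the two parts add up to that of [w]. *)
  have FE G : unsh_sum w (fun a b => (size a)%:R * G a b) +
              unsh_sum w (fun a b => (size b)%:R * G a b) = (size w)%:R * unsh_sum w G.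
    rewrite -unsh_sumD mulr_sumr; apply: eq_big_seq => d /size_unsh <-.
    by rewrite natrD mulrDl.
  rewrite /H sc_delta_SC big_map -[\sum_(d <- _) _]/(unsh_sum w (fun a b => F (SC a) (SC b))).
  rewrite -FE /X (eq_unsh_sum _ (fun u v => unsh_sumD _ _ _)) unsh_sumD.
  congr (_ + _); last first.
    rewrite unsh_sumA; apply: eq_unsh_sum => a b.
    exact: (dynkin_convolution b (F (SC a))).
  (* Cocommutativity puts the part multiplied by [dynkin v] next to [v], so that coassociativity can
     group the two. *)
  rewrite (eq_unsh_sum _ (fun u v => unsh_sumC _ _)).
  rewrite (unsh_sumA w (fun b a v => ev (dynkin v) (fun Q => F (sc_mul (SC a) Q) (SC b)))).
  rewrite [RHS]unsh_sumC; apply: eq_unsh_sum => a b.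
  exact: (dynkin_convolution b (fun P => F P (SC a))).
(* Two sums over splittings agree, and by [HX] so do their terms with non-empty left part; what
   remains is the claim for [w]. *)
have := dynkin_convolution w H; rewrite -sumX /unsh_sum.
rewrite (bigID (fun d => d.1 == [::])) [RHS](bigID (fun d => d.1 == [::])) /=.
rewrite (unsh_sum_left_nil w X) X0.
rewrite (unsh_sum_left_nil w (fun a b => ev (dynkin b) (fun Q => H (sc_mul (SC a) Q)))).
rewrite [X in _ + X = _](_ : _ = \sum_(d <- unsh w | d.1 != [::]) X d.1 d.2).
  by move/addIr <-; apply: eq_ev => Q; rewrite SC_nil sc_0mul.
rewrite big_seq_cond [RHS]big_seq_cond; apply: eq_bigr => d /andP[dw d1].
exact: HX.
Qed.

Lemma primitive_scale a (x : lc R) : primitive x -> primitive (lc_scale a x).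
Proof.
move=> h PQ; have := h PQ; rewrite /coef2 !coef_ev !ev_delta ev_scale => ->.
by rewrite !ev_cat mulrDr /ev !big_map !mulr_sumr; congr (_ + _);
  apply: eq_bigr => p _; rewrite mulrA.
Qed.

End Dynkin.

Section Rational.

Definition gen_word (i : gen) : seq nat :=
  sval (cid2 ((is_LITP (val i)).1 (genP i).1)).

Lemma gen_wordP i : avoid (gen_word i) /\ SC (gen_word i) = val i.
Proof. by rewrite /gen_word; case: cid2. Qed.

Lemma size_gen_word i : (0 < size (gen_word i))%N.
Proof.
have [_ e] := gen_wordP i; rewrite -size_SC e.
by apply: LIT_size (gen_neq0 (genP i)); case: (genP i).
Qed.

(** Dividing by the degree makes the leading coefficient 1, which is what calls for rational
    scalars. *)
Definition primitive_gen (i : gen) : lc rat :=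
  lc_scale (size (gen_word i))%:R^-1 (dynkin rat (gen_word i)).

Lemma primitive_gens_freely_generate : freely_generates primitive_gen.
Proof.
apply: (triangular_freely_generates (r := fun i =>
  lc_scale (size (gen_word i))%:R^-1 (dynkin_tail rat (gen_word i)))) => i.
- rewrite /primitive_gen dynkinE /lc_scale /= mulVf ?(gen_wordP i).2 //.
  by rewrite Num.Theory.pnatr_eq0 -lt0n size_gen_word.
- by move=> p /mapP[q qt ->]; apply: (dynkin_tail_length (gen_wordP i).1 qt).
- move=> p /mapP[q qt ->] /=; have [aw e] := gen_wordP i.
  have w0 : gen_word i != [::] by rewrite -size_eq0 -lt0n size_gen_word.
  have [|_ _ ->] := @dynkin_supported rat _ aw w0 q.
    by rewrite dynkinE inE qt orbT.
  by rewrite -e size_SC.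
Qed.

Lemma primitive_gen_primitive i : primitive (primitive_gen i).
Proof. exact/primitive_scale/dynkin_primitive/(gen_wordP i).1. Qed.

End Rational.

Theorem theorem4p8 :
  (* the Z-span of left increasing trees is a Hopf subalgebra of
     (T_bullet, overline-*, hat-delta): unit, product, coproduct, antipode *)
  in_LIT (lc_one int) /\
  (forall x y : lc int, in_LIT x -> in_LIT y -> in_LIT (lc_mul x y)) /\
  (forall x : lc int, in_LIT x -> in_LIT2 (lc_delta x)) /\
  (forall x : lc int, in_LIT x -> in_LIT (lc_antipode x)) /\
  (* Inc is injective on trees, so the span of trees inherits this structure *)
  (forall t1 t2 : tree, wf_tree t1 -> wf_tree t2 ->
     sigma (Inc t1).1 (Inc t1).2 = sigma (Inc t2).1 (Inc t2).2 -> t1 = t2) /\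
  (* free as an associative algebra over Z *)
  (exists (I : eqType) (g : I -> lc int), freely_generates g) /\
  (* over Q: freely generated by primitive elements, i.e. it is the universal
     enveloping algebra of the free Lie algebra on these primitives *)
  (exists (I : eqType) (g : I -> lc rat),
     freely_generates g /\ forall i, primitive (g i)).
Proof.
split; first exact: in_LIT_one.
split; first exact: in_LIT_mul.
split; first exact: in_LIT_delta.
split; first exact: in_LIT_antipode.
split; first exact: Inc_inj.
split; first by exists gen, (fun i : gen => [:: (1%R : int, val i)]); exact: generators_freely_generate.
exists gen, primitive_gen; split; first exact: primitive_gens_freely_generate.
exact: primitive_gen_primitive.
Qed.
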